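(* Let $(\Sigma,P)$ be a string rewrite system. For every proof term $\gamma$ there exists a unique greedy multistep reduction $\gamma'$ such that $\gamma$ and $\gamma'$ are permutation equivalent.
   Context: An alphabet $\Sigma$ has unique reading (if $a_1\cdots a_n=b_1\cdots b_m$ with letters $a_i,b_j$ then $n=m$ and $a_k=b_k$); strings are elements of the free monoid over $\Sigma$ with empty string $\varepsilon$. A string rewrite system $(\Sigma,P)$ has rules $\varrho:\ell\to r$ with $\ell,r$ nonempty strings, treated as nullary symbols. Proof terms are built from $\varepsilon$, letters, rule symbols, juxtaposition $\gamma\delta$ and vertical composition $\gamma\cdot\delta$ (horizontal composition considered modulo the monoid laws), with sources and targets $\gamma:s\Rightarrow t$: $\varepsilon:\varepsilon\Rightarrow\varepsilon$; $a:a\Rightarrow a$; $\varrho:\ell\Rightarrow r$; $\gamma_1\gamma_2:s_1s_2\Rightarrow t_1t_2$ if $\gamma_i:s_i\Rightarrow t_i$; $\gamma\cdot\delta:s\Rightarrow u$ if $\gamma:s\Rightarrow t,\ \delta:t\Rightarrow u$. Permutation equivalence is the congruence on proof terms generated by (both sides required to be proof terms) $\varepsilon\gamma=\gamma$, $\gamma\varepsilon=\gamma$, $(\gamma\delta)\zeta=\gamma(\delta\zeta)$, $s\cdot\gamma=\gamma$, $\gamma\cdot t=\gamma$ (strings $s,t$), $(\gamma\cdot\delta)\cdot\zeta=\gamma\cdot(\delta\cdot\zeta)$, $\gamma\delta\cdot\zeta\eta=(\gamma\cdot\zeta)(\delta\cdot\eta)$. A multistep is a proof term with no vertical composition; step: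 exactly one rule-symbol occurrence; empty: none. A multistep reduction is an empty multistep or a right-associated vertical composition $\Phi_1\cdot(\Phi_2\cdot(\cdots\cdot\Phi_n))$ of nonempty multisteps. For multisteps $\Phi,\Psi$ with the same source, $\Phi\le\Psi$ means $\Phi$ is obtained from $\Psi$ by replacing some rule-symbol occurrences by their left-hand sides; the residual $\Psi/\Phi$ is obtained from $\Psi$ by replacing the other occurrences (those still rules in $\Phi$) by their right-hand sides. A pair $\Phi\cdot\Psi$ of consecutive multisteps is loath if there is a multistep $X$ with the same source as $\Phi$, $\Phi\le X$, such that $\psi:=X/\Phi$ is a step with $\psi\le\Psi$. A multistep reduction is greedy if no pair of consecutive multisteps in it is loath. *)

(* Defs.v *)
From mathcomp Require Import all_boot.

Set Implicit Arguments.
Unset Strict Implicit.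
Unset Printing Implicit Defensive.

(* Strings are sequences of letters, i.e. elements of the free monoid, so unique
   reading is built in.  The alphabet and the set of rule symbols are arbitrary
   (possibly infinite); distinct rule symbols may have the same sides. *)
Record srs := SRS {
  letter : Type;
  rule : Type;
  lhs : rule -> seq letter;
  rhs : rule -> seq letter;
  lhs_nonempty : forall p : rule, lhs p <> [::];
  rhs_nonempty : forall p : rule, rhs p <> [::]
}.

(* Preterms modulo the monoid laws of horizontal composition: a preterm is an
   element of the free monoid over the letters, the rule symbols, and the formal
   vertical compositions of two preterms.  Thus [::] is the empty string, ++ is
   juxtaposition, and Leibniz equality is equality modulo the monoid laws;
   vertical composition is purely syntactic. *)
Inductive atom (S : srs) : Type :=
| Letter of letter S
| Rule of rule S
| Vert of seq (atom S) & seq (atom S).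

Arguments Letter {S} _.
Arguments Rule {S} _.
Arguments Vert {S} _ _.

Definition preterm (S : srs) : Type := seq (atom S).

Definition str (S : srs) (s : seq (letter S)) : preterm S :=
  [seq Letter a | a <- s].

Definition vert (S : srs) (g d : preterm S) : preterm S := [:: Vert g d].

(* [derives g s t] is  g : s => t. *)
Inductive derives (S : srs) :
  preterm S -> seq (letter S) -> seq (letter S) -> Prop :=
| derives_nil : derives [::] [::] [::]
| derives_letter a : derives [:: Letter a] [:: a] [:: a]
| derives_rule p : derives [:: Rule p] (lhs p) (rhs p)
| derives_cat g1 g2 s1 s2 t1 t2 :
    derives g1 s1 t1 -> derives g2 s2 t2 ->
    derives (g1 ++ g2) (s1 ++ s2) (t1 ++ t2)
| derives_vert g d s t u :
    derives g s t -> derives d t u -> derives (vert g d) s u.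

Definition proof_term (S : srs) (g : preterm S) : Prop :=
  exists s t, derives g s t.

(* The unit and associativity laws of juxtaposition need no constructor: they
   are equalities of preterms, hence instances of reflexivity. *)
Inductive perm_equiv (S : srs) : preterm S -> preterm S -> Prop :=
| pe_refl g : proof_term g -> perm_equiv g g
| pe_sym g d : perm_equiv g d -> perm_equiv d g
| pe_trans g d z : perm_equiv g d -> perm_equiv d z -> perm_equiv g z
| pe_cat g g' d d' :
    perm_equiv g g' -> perm_equiv d d' -> perm_equiv (g ++ d) (g' ++ d')
| pe_vert g g' d d' :
    perm_equiv g g' -> perm_equiv d d' ->
    proof_term (vert g d) -> proof_term (vert g' d') ->
    perm_equiv (vert g d) (vert g' d')
| pe_idl s g :
    proof_term (vert (str s) g) -> proof_term g ->
    perm_equiv (vert (str s) g) g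
| pe_idr g t :
    proof_term (vert g (str t)) -> proof_term g ->
    perm_equiv (vert g (str t)) g
| pe_assoc g d z :
    proof_term (vert (vert g d) z) -> proof_term (vert g (vert d z)) ->
    perm_equiv (vert (vert g d) z) (vert g (vert d z))
| pe_exchange g d z e :
    proof_term (vert (g ++ d) (z ++ e)) ->
    proof_term (vert g z ++ vert d e) ->
    perm_equiv (vert (g ++ d) (z ++ e)) (vert g z ++ vert d e).

Definition is_vert (S : srs) (x : atom S) : bool :=
  if x is Vert _ _ then true else false.

Definition is_rule (S : srs) (x : atom S) : bool :=
  if x is Rule _ then true else false.

(* Preterms without vertical composition are always proof terms. *)
Definition multistep (S : srs) (g : preterm S) : bool :=
  ~~ has (@is_vert S) g.

Definition empty_multistep (S : srs) (g : preterm S) : bool :=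
  multistep g && (count (@is_rule S) g == 0).

Definition nonempty_multistep (S : srs) (g : preterm S) : bool :=
  multistep g && (0 < count (@is_rule S) g).

Definition step (S : srs) (g : preterm S) : bool :=
  multistep g && (count (@is_rule S) g == 1).

(* [mle F G] is  F <= G; it relates only multisteps with the same source. *)
Inductive mle (S : srs) : preterm S -> preterm S -> Prop :=
| mle_nil : mle [::] [::]
| mle_letter a F G : mle F G -> mle (Letter a :: F) (Letter a :: G)
| mle_keep p F G : mle F G -> mle (Rule p :: F) (Rule p :: G)
| mle_replace p F G : mle F G -> mle (str (lhs p) ++ F) (Rule p :: G).

(* [residual G F H] is  G / F = H  (for F <= G), as the graph of an operation:
   nonemptiness of left-hand sides makes the occurrences of G that remain rules
   in F, hence H, unique, cf. [residual_exists] and [residual_unique]. *)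
Inductive residual (S : srs) : preterm S -> preterm S -> preterm S -> Prop :=
| res_nil : residual [::] [::] [::]
| res_letter a G F H :
    residual G F H -> residual (Letter a :: G) (Letter a :: F) (Letter a :: H)
| res_keep p G F H :
    residual G F H ->
    residual (Rule p :: G) (Rule p :: F) (str (rhs p) ++ H)
| res_replace p G F H :
    residual G F H ->
    residual (Rule p :: G) (str (lhs p) ++ F) (Rule p :: H).

Lemma residual_exists (S : srs) (F G : preterm S) :
  mle F G <-> exists H, residual G F H.
Proof.
split.
- by elim=> [|a {}F {}G _ [H r]|p {}F {}G _ [H r]|p {}F {}G _ [H r]];
    eexists; constructor; eassumption.
- by case=> H; elim=> *; constructor.
Qed.

Lemma residual_unique (S : srs) (G F H H' : preterm S) :
  residual G F H -> residual G F H' -> H = H'.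
Proof.
move=> r; elim: r H' => {G F H}
  [|a G F H _ IH|p G F H _ IH|p G F H _ IH] H' r'.
- by inversion r'.
- by inversion r'; subst; congr cons; apply: IH.
- inversion r' as [| |q G1 F1 H1 r1|q G1 F1 H1 r1 e1 e2]; subst.
    by rewrite (IH _ r1).
  by case: (lhs p) (@lhs_nonempty S p) e2 => // /(_ erefl).
- inversion r' as [| |q G1 F1 H1 r1 e1 e2|q G1 F1 H1 r1 e1 e2]; subst.
    by case: (lhs p) (@lhs_nonempty S p) e2 => // /(_ erefl).
  congr cons; apply: IH; move: e2.
  elim: (str (lhs p)) => /= [<- //|x s IHs [e]]; exact: IHs.
Qed.

Definition loath (S : srs) (F G : preterm S) : Prop :=
  exists X f : preterm S,
    [/\ mle F X, residual X F f, step f & mle f G].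

Fixpoint vcomp (S : srs) (F : preterm S) (Fs : seq (preterm S)) : preterm S :=
  if Fs is G :: Gs then vert F (vcomp G Gs) else F.

(* [composed_of g F Fs]: g is the vertical composition of the nonempty
   multisteps F :: Fs.  Since multisteps contain no vertical composition, F and
   Fs are determined by g. *)
Definition composed_of (S : srs) (g F : preterm S) (Fs : seq (preterm S)) :
    Prop :=
  [/\ g = vcomp F Fs, all (@nonempty_multistep S) (F :: Fs) & proof_term g].

Definition multistep_reduction (S : srs) (g : preterm S) : Prop :=
  empty_multistep g \/ exists F Fs, composed_of g F Fs.

Definition greedy (S : srs) (g : preterm S) : Prop :=
  multistep_reduction g /\
  forall F Fs, composed_of g F Fs ->
  forall Ls G1 G2 Rs, F :: Fs = Ls ++ [:: G1, G2 & Rs] -> ~ loath G1 G2.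

(* Main.v *)
Require Import Defs.
From mathcomp Require Import all_boot zify.
From Stdlib Require Import Classical_Prop.

Set Implicit Arguments.
Unset Strict Implicit.
Unset Printing Implicit Defensive.

(** Existence: every proof term is equivalent to a vertical composition of
    multisteps F_1, ..., F_n.  Dropping an empty multistep, or moving a step of
    F_(k+1) into F_k when the pair is loath, decreases the sum of
    (k + 1) * (number of rules of F_k + 1), so a greedy reduction is reached.

    Uniqueness: let proof terms act on strings of tokens, i.e. of letters that
    remember which rule produced them and from which tokens.  Permutation
    equivalent terms act in the same way, and in a greedy reduction the tokens
    produced by F_k are exactly those whose history has depth k.  As right-hand
    sides are nonempty, the token string resulting from the reduction thus
    determines its last multistep together with the token string before it, and
    hence, recursively, the whole reduction. *)

(** * Types of proof terms *)

Definition atom_type (S : srs) (x : atom S) (s t : seq (letter S)) : Prop :=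
  match x with
  | Letter a => s = [:: a] /\ t = [:: a]
  | Rule p => s = lhs p /\ t = rhs p
  | Vert g d => exists2 m, derives g s m & derives d m t
  end.

Lemma atom_type_derives (S : srs) (x : atom S) s t :
  atom_type x s t -> derives [:: x] s t.
Proof.
by case: x => [a [-> ->]|p [-> ->]|g d [m gm md]]; econstructor; eassumption.
Qed.

(** [derives_cat] may cut a preterm anywhere, even next to an empty part, so plain inversion is
    ambiguous. Peeling off the head atom gives a canonical reading. *)
Lemma derives_inv (S : srs) (g : preterm S) s t :
  derives g s t ->
  match g with
  | [::] => s = [::] /\ t = [::]
  | x :: g' => exists s1 s2 t1 t2,
      [/\ s = s1 ++ s2, t = t1 ++ t2, atom_type x s1 t1 & derives g' s2 t2]
  end.
Proof.
elim=> {g s t} [|a|p|[|x g1] g2 s1 s2 t1 t2 d1 IH1 d2 IH2|g d s m t d1 _ d2 _].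
- by [].
- by exists [:: a], [::], [:: a], [::]; split=> //; constructor.
- by exists (lhs p), [::], (rhs p), [::]; rewrite !cats0; split=> //; constructor.
- by case: IH1 => -> ->.
- case: IH1 => u1 [u2] [v1] [v2] [-> -> tx tg].
  exists u1, (u2 ++ s2), v1, (v2 ++ t2).
  by rewrite -!catA; split=> //; apply: derives_cat.
- exists s, [::], t, [::]; rewrite !cats0; split=> //; last by constructor.
  by exists m.
Qed.

Lemma derives_cat_inv (S : srs) (g d : preterm S) s t :
  derives (g ++ d) s t ->
  exists s1 s2 t1 t2,
    [/\ s = s1 ++ s2, t = t1 ++ t2, derives g s1 t1 & derives d s2 t2].
Proof.
elim: g s t => [|x g IH] s t /=.
  by exists [::], s, [::], t; split=> //; constructor.
move/derives_inv => [s1] [s2] [t1] [t2] [-> -> tx /IH].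
move=> [u1] [u2] [v1] [v2] [-> -> tg td].
exists (s1 ++ u1), u2, (t1 ++ v1), v2; rewrite -!catA; split=> //.
rewrite -cat1s; apply: derives_cat tg; exact: atom_type_derives.
Qed.

Lemma derives_vert_inv (S : srs) (g d : preterm S) s t :
  derives (vert g d) s t -> exists2 m, derives g s m & derives d m t.
Proof.
move/derives_inv => [s1] [s2] [t1] [t2] [-> -> tx /derives_inv [-> ->]].
by rewrite !cats0.
Qed.

Lemma derives_unique (S : srs) (g : preterm S) s t s' t' :
  derives g s t -> derives g s' t' -> s = s' /\ t = t'.
Proof.
move=> d1; elim: d1 s' t' => {g s t}
  [|a|p|g1 g2 s1 s2 t1 t2 _ IH1 _ IH2|g d s m t _ IH1 _ IH2] s' t'.
- by move/derives_inv => [-> ->].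
- by move/derives_inv => [?] [?] [?] [?] [-> -> [-> ->] /derives_inv [-> ->]].
- move/derives_inv => [?] [?] [?] [?] [-> -> [-> ->] /derives_inv [-> ->]].
  by rewrite !cats0.
- by move/derives_cat_inv => [?] [?] [?] [?] [-> -> /IH1 [-> ->] /IH2 [-> ->]].
- by move/derives_vert_inv => [m' /IH1 [-> <-] /IH2 [_ ->]].
Qed.

Lemma derives_str (S : srs) (s : seq (letter S)) : derives (str s) s s.
Proof.
elim: s => [|a s IH]; first by constructor.
rewrite -cat1s; apply: (@derives_cat S [:: Letter a] (str s)) => //.
exact: derives_letter.
Qed.

Lemma str_cat (S : srs) (s t : seq (letter S)) : str (s ++ t) = str s ++ str t.
Proof. exact: map_cat. Qed.

(** * Permutation equivalence of proof terms of a given type *)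

(** Carrying the type along lets the side conditions of [perm_equiv], that both sides be proof
    terms, be discharged once and for all in the lemmas below. *)
Definition eqv (S : srs) s t (g d : preterm S) : Prop :=
  [/\ derives g s t, derives d s t & perm_equiv g d].

Lemma perm_equiv_eqv (S : srs) (g d : preterm S) :
  perm_equiv g d -> exists s t, eqv s t g d.
Proof.
move=> e; suff: exists s t, derives g s t /\ derives d s t.
  by case=> s [t] [gs ds]; exists s, t.
elim: e => {g d}.
- by move=> g [s] [t] gs; exists s, t.
- by move=> g d _ [s] [t] [gs ds]; exists s, t.
- move=> g d z _ [s] [t] [gs ds] _ [s'] [t'] [ds' zs].
  by have [e1 e2] := derives_unique ds ds'; subst; exists s', t'.
- move=> g g' d d' _ [s] [t] [gs ds] _ [s'] [t'] [ds' zs].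
  by exists (s ++ s'), (t ++ t'); split; apply: derives_cat.
- move=> g g' d d' _ [s] [t] [gs ds] _ [s'] [t'] [ds' zs].
  move=> [u] [v] /derives_vert_inv [m gm dm] _.
  have [? ?] := derives_unique gs gm; have [? ?] := derives_unique ds' dm.
  by subst; exists u, v; split; apply: derives_vert; eassumption.
- move=> s g [u] [v] h _; exists u, v; split=> //.
  case/derives_vert_inv: h => m h1 h2.
  by have [e1 e2] := derives_unique h1 (derives_str s); subst.
- move=> g s [u] [v] h _; exists u, v; split=> //.
  case/derives_vert_inv: h => m h1 h2.
  by have [e1 e2] := derives_unique h2 (derives_str s); subst.
- move=> g d z [u] [v] h _; exists u, v; split=> //.
  case/derives_vert_inv: h => m /derives_vert_inv [n h1 h2] h3.
  by apply: derives_vert h1 _; apply: derives_vert h2 h3.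
(* The type is read off the right-hand side: a typing of the left-hand side alone does not force the
   target of [g] to be the source of [z]. *)
- move=> g d z e _ [u] [v] h; exists u, v; split=> //.
  case/derives_cat_inv: h => u1 [u2] [v1] [v2] [-> ->].
  move=> /derives_vert_inv [m g1 z1] /derives_vert_inv [n d1 e1].
  by apply: derives_vert (derives_cat g1 d1) (derives_cat z1 e1).
Qed.

Section Eqv.

Variable S : srs.
Implicit Types (g d z e : preterm S) (s t u v : seq (letter S)).

Lemma proof_termI g s t : derives g s t -> proof_term g.
Proof. by exists s, t. Qed.

Lemma eqv_refl s t g : derives g s t -> eqv s t g g.
Proof. by move=> gs; split=> //; apply/pe_refl/proof_termI/gs. Qed.

Lemma eqv_sym s t g d : eqv s t g d -> eqv s t d g.
Proof. by case=> *; split=> //; apply: pe_sym. Qed.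

Lemma eqv_trans s t g d z : eqv s t g d -> eqv s t d z -> eqv s t g z.
Proof. by case=> ? ? ? [? ? ?]; split=> //; apply: pe_trans; eassumption. Qed.

Lemma eqv_cat s t u v g g' d d' :
  eqv s t g g' -> eqv u v d d' -> eqv (s ++ u) (t ++ v) (g ++ d) (g' ++ d').
Proof. by case=> ? ? ? [? ? ?]; split; [exact: derives_cat..|exact: pe_cat]. Qed.

Lemma eqv_vert s t u g g' d d' :
  eqv s t g g' -> eqv t u d d' -> eqv s u (vert g d) (vert g' d').
Proof.
case=> gs gs' e [ds ds' e'].
have h := derives_vert gs ds; have h' := derives_vert gs' ds'.
split=> //; apply: pe_vert e e' _ _; apply: proof_termI; eassumption.
Qed.

Lemma eqv_idl s t g : derives g s t -> eqv s t (vert (str s) g) g.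
Proof.
move=> gs; have h := derives_vert (derives_str s) gs.
by split=> //; apply: pe_idl; apply: proof_termI; eassumption.
Qed.

Lemma eqv_idr s t g : derives g s t -> eqv s t (vert g (str t)) g.
Proof.
move=> gs; have h := derives_vert gs (derives_str t).
by split=> //; apply: pe_idr; apply: proof_termI; eassumption.
Qed.

Lemma eqv_assoc s t u v g d z :
  derives g s t -> derives d t u -> derives z u v ->
  eqv s v (vert (vert g d) z) (vert g (vert d z)).
Proof.
move=> gs ds zs.
have h := derives_vert (derives_vert gs ds) zs.
have h' := derives_vert gs (derives_vert ds zs).
by split=> //; apply: pe_assoc; apply: proof_termI; eassumption.
Qed.

Lemma eqv_exchange s1 m1 t1 s2 m2 t2 g d z e :
  derives g s1 m1 -> derives z m1 t1 -> derives d s2 m2 -> derives e m2 t2 ->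
  eqv (s1 ++ s2) (t1 ++ t2) (vert (g ++ d) (z ++ e)) (vert g z ++ vert d e).
Proof.
move=> gs zs ds es.
have h := derives_vert (derives_cat gs ds) (derives_cat zs es).
have h' := derives_cat (derives_vert gs zs) (derives_vert ds es).
by split=> //; apply: pe_exchange; apply: proof_termI; eassumption.
Qed.

End Eqv.

(** * Existence *)

Section Existence.

Variable S : srs.
Implicit Types (F G H X g : preterm S) (Fs Gs : seq (preterm S)).
Implicit Types (s t u : seq (letter S)).

(* Unlike [vcomp], this also makes sense for an empty sequence. *)
Definition vcomp_to t Fs : preterm S := foldr (@vert S) (str t) Fs.

Lemma vcomp_to_cat s t u Fs Gs :
  derives (vcomp_to t Fs) s t -> derives (vcomp_to u Gs) t u ->
  eqv s u (vert (vcomp_to t Fs) (vcomp_to u Gs)) (vcomp_to u (Fs ++ Gs)).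
Proof.
elim: Fs s => [|F Fs IH] s /=.
  move=> h1 h2; have [? _] := derives_unique h1 (derives_str t); subst.
  exact: eqv_idl.
move=> /derives_vert_inv [m h1 h2] h3.
apply: eqv_trans (eqv_assoc h1 h2 h3) _.
by apply: eqv_vert (eqv_refl h1) _; apply: IH.
Qed.

(** Juxtaposed reductions are sequentialised: first the left one runs beside the idle source [s2],
    then the right one beside the idle target [t1]. At each stage the idle side is padded with an
    identity and the exchange law is applied. *)
Lemma cat_vcomp_to s1 t1 s2 t2 Fs Gs :
  derives (vcomp_to t1 Fs) s1 t1 -> derives (vcomp_to t2 Gs) s2 t2 ->
  eqv (s1 ++ s2) (t1 ++ t2) (vcomp_to t1 Fs ++ vcomp_to t2 Gs)
    (vcomp_to (t1 ++ t2)
       ([seq F ++ str s2 | F <- Fs] ++ [seq str t1 ++ G | G <- Gs])).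
Proof.
move=> h1 h2; elim: Fs s1 h1 => [|F Fs IH] s1 /=.
  move=> h1; have [? _] := derives_unique h1 (derives_str t1); subst.
  elim: Gs s2 h2 => [|G Gs IH] s2 /=.
    move=> h2; have [? _] := derives_unique h2 (derives_str t2); subst.
    by rewrite /vcomp_to /= str_cat; apply: eqv_refl; apply: derives_cat.
  move=> /derives_vert_inv [m h2 h3].
  have hs := derives_str t1.
  apply: eqv_trans (eqv_cat (eqv_sym (eqv_idl hs))
                            (eqv_refl (derives_vert h2 h3))) _.
  apply: eqv_trans (eqv_sym (eqv_exchange hs hs h2 h3)) _.
  by apply: eqv_vert (IH _ h3); apply/eqv_refl/derives_cat.
move=> /derives_vert_inv [m h1 h3].
have hs := derives_str s2.
apply: eqv_trans (eqv_cat (eqv_refl (derives_vert h1 h3))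
                          (eqv_sym (eqv_idl h2))) _.
apply: eqv_trans (eqv_sym (eqv_exchange h1 h3 hs h2)) _.
by apply: eqv_vert (IH _ h3); apply/eqv_refl/derives_cat.
Qed.

Lemma multistep_cat F G : multistep (F ++ G) = multistep F && multistep G.
Proof. by rewrite /multistep has_cat negb_or. Qed.

Lemma multistep_str s : multistep (str s).
Proof. by elim: s. Qed.

Lemma count_rule_str s : count (@is_rule S) (str s) = 0.
Proof. by elim: s. Qed.

(** Induction on the typing: [cat_vcomp_to] handles juxtaposition and [vcomp_to_cat] vertical
    composition. *)
Lemma derives_eqv_vcomp_to g s t :
  derives g s t ->
  exists2 Fs, all (@multistep S) Fs & eqv s t g (vcomp_to t Fs).
Proof.
elim=> {g s t} [|a|p|g1 g2 s1 s2 t1 t2 _ [Fs mF e1] _ [Gs mG e2]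
  |g d s t u _ [Fs mF e1] _ [Gs mG e2]].
- by exists [::] => //; apply/eqv_refl/derives_nil.
- by exists [::] => //; apply/eqv_refl/derives_letter.
- by exists [:: [:: Rule p]] => //; apply/eqv_sym/eqv_idr/derives_rule.
- exists ([seq F ++ str s2 | F <- Fs] ++ [seq str t1 ++ G | G <- Gs]).
    rewrite all_cat !all_map; apply/andP; split.
      by apply: sub_all mF => F; rewrite /= multistep_cat multistep_str andbT.
    by apply: sub_all mG => G; rewrite /= multistep_cat multistep_str.
  by apply: eqv_trans (eqv_cat e1 e2) (cat_vcomp_to _ _); [case: e1|case: e2].
- exists (Fs ++ Gs); first by rewrite all_cat mF.
  by apply: eqv_trans (eqv_vert e1 e2) (vcomp_to_cat _ _); [case: e1|case: e2].
Qed.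

(** * Residuals and loath pairs *)

(** By an identity law, each atom of [G] is its part in [F] followed by its part in [H]; the
    exchange law, packaged in [juxtapose], glues these blocks together. *)
Lemma residual_eqv G F H :
  residual G F H ->
  exists s m t, [/\ derives F s m, derives H m t & eqv s t (vert F H) G].
Proof.
have juxtapose x y z s1 m1 t1 G' F' H' :
    derives x s1 m1 -> derives y m1 t1 -> eqv s1 t1 (vert x y) z ->
    (exists s m t,
       [/\ derives F' s m, derives H' m t & eqv s t (vert F' H') G']) ->
    exists s m t, [/\ derives (x ++ F') s m, derives (y ++ H') m t
      & eqv s t (vert (x ++ F') (y ++ H')) (z ++ G')].
  move=> dx dy e1 [s] [m] [t] [dF dH e2].
  exists (s1 ++ s), (m1 ++ m), (t1 ++ t).
  split; [exact: derives_cat..|].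
  by apply: eqv_trans (eqv_exchange dx dy dF dH) _; apply: eqv_cat.
elim=> {G F H} [|a G F H _|p G F H _|p G F H _].
- exists [::], [::], [::]; split; [exact: derives_nil..|].
  exact: (eqv_idl (derives_nil S)).
- have da := derives_letter a.
  by apply: (juxtapose _ _ _ _ _ _ _ _ _ da da (eqv_idl da)).
- have dp := derives_rule p; have ds := derives_str (rhs p).
  by apply: (juxtapose _ _ _ _ _ _ _ _ _ dp ds (eqv_idr dp)).
- have dp := derives_rule p; have ds := derives_str (lhs p).
  by apply: (juxtapose _ _ _ _ _ _ _ _ _ ds dp (eqv_idl dp)).
Qed.

Lemma residual_count G F H :
  residual G F H ->
  count (@is_rule S) G = count (@is_rule S) F + count (@is_rule S) H.
Proof.
elim=> {G F H} //= *; rewrite ?count_cat ?count_rule_str; lia.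
Qed.

Lemma residual_multistep G F H :
  residual G F H -> multistep G /\ multistep H.
Proof.
elim=> {G F H} //= [p G F H _ [mG mH]].
by split=> //; rewrite multistep_cat multistep_str.
Qed.

(** With [G'] the residual of [G] after the loath step [f], associativity gives F·G = F·(f·G') =
    (F·f)·G' = X·G', which moves exactly one rule to the left. *)
Lemma loath_improve F G s m t :
  loath F G -> derives F s m -> derives G m t ->
  exists X G' m', [/\ multistep X && multistep G',
    derives X s m', derives G' m' t, eqv s t (vert F G) (vert X G')
    & count (@is_rule S) X = (count (@is_rule S) F).+1 /\
      count (@is_rule S) G = (count (@is_rule S) G').+1].
Proof.
case=> X [f] [_ rX /andP [_ /eqP cf] /residual_exists [G' rG]] dF dG.
have [s1 [m1 [t1 [dF' df eX]]]] := residual_eqv rX.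
have [? ?] := derives_unique dF dF'; subst s1 m1.
have [s2 [m2 [t2 [df' dG' eG]]]] := residual_eqv rG.
have [? ?] := derives_unique df df'; subst s2 m2.
have [_ dG2 _] := eG; have [_ ?] := derives_unique dG dG2; subst t2.
have [_ dX _] := eX.
exists X, G', t1; split=> //.
- by rewrite (residual_multistep rX).1 (residual_multistep rG).2.
- apply: eqv_trans (eqv_vert (eqv_refl dF) (eqv_sym eG)) _.
  apply: eqv_trans (eqv_sym (eqv_assoc dF df dG')) _.
  by apply: eqv_vert eX (eqv_refl dG').
- by rewrite (residual_count rX) (residual_count rG) cf addn1.
Qed.

(** * Termination by weight *)

(** Counting positions from 1, this is the sum of k times (1 + number of rules of the k-th
    multistep): the last summand accounts for the shift of the tail by one position. The successor
    makes even the removal of an empty multistep a strict decrease. *)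
Fixpoint weight Fs : nat :=
  if Fs is F :: Gs then
    (count (@is_rule S) F).+1 + weight Gs
      + sumn [seq (count (@is_rule S) G).+1 | G <- Gs]
  else 0.

Lemma derives_vcomp_to_cat_inv s u Fs Gs :
  derives (vcomp_to u (Fs ++ Gs)) s u ->
  exists2 t, derives (vcomp_to t Fs) s t & derives (vcomp_to u Gs) t u.
Proof.
elim: Fs s => [|F Fs IH] s /=.
  by exists s => //; apply: derives_str.
move=> /derives_vert_inv [m dF /IH [t dFs dGs]].
by exists t => //; apply: derives_vert dF dFs.
Qed.

Lemma eqv_vcomp_to_cat s t u Fs Gs Gs' :
  derives (vcomp_to t Fs) s t -> eqv t u (vcomp_to u Gs) (vcomp_to u Gs') ->
  eqv s u (vcomp_to u (Fs ++ Gs)) (vcomp_to u (Fs ++ Gs')).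
Proof.
elim: Fs s => [|F Fs IH] s /= h e.
  by have [-> _] := derives_unique h (derives_str t).
case/derives_vert_inv: h => m dF h.
by apply: eqv_vert (eqv_refl dF) _; apply: IH.
Qed.

(** A prefix shifts every later position by its length, so it adds a multiple of the unweighted sum
    of the tail; hence the second hypothesis. *)
Lemma weight_cat_lt Fs Gs Gs' :
  weight Gs < weight Gs' ->
  sumn [seq (count (@is_rule S) G).+1 | G <- Gs]
    <= sumn [seq (count (@is_rule S) G).+1 | G <- Gs'] ->
  weight (Fs ++ Gs) < weight (Fs ++ Gs').
Proof.
move=> h1 h2; elim: Fs => [|F Fs IH] //=.
rewrite !map_cat !sumn_cat; lia.
Qed.

Lemma empty_multistep_str F :
  multistep F -> count (@is_rule S) F = 0 -> exists s, F = str s.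
Proof.
elim: F => [|[a|p|g d] F IH] //=; first by exists [::].
by move=> mF /(IH mF) [s ->]; exists (a :: s).
Qed.

Definition unloath Fs : Prop :=
  forall Ls G1 G2 Rs, Fs = Ls ++ [:: G1, G2 & Rs] -> ~ loath G1 G2.

Lemma vcomp_to_unloath Fs s t :
  all (@multistep S) Fs -> derives (vcomp_to t Fs) s t ->
  exists Gs, [/\ all (@nonempty_multistep S) Gs, unloath Gs
    & eqv s t (vcomp_to t Fs) (vcomp_to t Gs)].
Proof.
have [n le_n] := ubnP (weight Fs).
elim: n Fs le_n => // n IHn Fs le_n mF dF.
(* Either the sequence can be made lighter, and the induction hypothesis applies, or it already has
   the required form. *)
suff [[Gs [lt_G mG eG]]|nF] : (exists Gs, [/\ weight Gs < weight Fs,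
    all (@multistep S) Gs & eqv s t (vcomp_to t Fs) (vcomp_to t Gs)])
    \/ all (@nonempty_multistep S) Fs /\ unloath Fs.
- have [_ dG _] := eG.
  have [|Hs [nH uH eH]] := IHn Gs _ mG dG; first lia.
  by exists Hs; split=> //; apply: eqv_trans eG eH.
- by exists Fs; split; [exact: nF.1|exact: nF.2|exact: eqv_refl].
have [nF|] := boolP (all (@nonempty_multistep S) Fs).
  (* Letters and rules come without decidable equality, so excluded middle settles whether a loath
     pair exists. *)
  have [uF|luF] := classic (unloath Fs); [by right|left].
  have [Ls [G1 [G2 [Rs [def_F l12]]]]] :
      exists Ls G1 G2 Rs, Fs = Ls ++ [:: G1, G2 & Rs] /\ loath G1 G2.
    apply: NNPP => h; apply: luF => Ls G1 G2 Rs def_F l12; apply: h.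
    by exists Ls, G1, G2, Rs.
  subst Fs; have [m dL] := derives_vcomp_to_cat_inv dF.
  move=> /= /derives_vert_inv [m1 d1 /derives_vert_inv [m2 d2 dR]].
  have [X [G' [m' [/andP [mX mG'] dX dG' e [cX cG]]]]] := loath_improve l12 d1 d2.
  exists (Ls ++ [:: X, G' & Rs]); split.
  (* One rule moves one position to the left: the unweighted sum is unchanged and the weight drops
     by one. *)
  - by apply: weight_cat_lt => /=; lia.
  - by move: mF; rewrite !all_cat /= mX mG' => /and4P [-> _ _ ->].
  - apply: eqv_vcomp_to_cat dL _ => /=.
    apply: eqv_trans (eqv_sym (eqv_assoc d1 d2 dR)) _.
    apply: eqv_trans (eqv_assoc dX dG' dR).
    by apply: eqv_vert e (eqv_refl dR).
(* Some multistep has no rule; it is then a string and is absorbed by an identity law. *)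
rewrite -has_predC => hF; left.
have [Ls [G [Rs [def_F]]]] :
    exists Ls G Rs, Fs = Ls ++ G :: Rs /\ ~~ nonempty_multistep G.
  elim: Fs hF {le_n mF dF} => //= F Fs IH.
  case/orP=> [nF|/IH [Ls [G [Rs [-> nG]]]]]; first by exists [::], F, Fs.
  by exists (F :: Ls), G, Rs.
subst Fs; move: mF; rewrite all_cat /= => /and3P [mL mG mR].
rewrite /nonempty_multistep mG /= -eqn0Ngt => /eqP cG.
have [u def_G] := empty_multistep_str mG cG; subst G.
have [m dL /= /derives_vert_inv [m' dG dR]] := derives_vcomp_to_cat_inv dF.
have [? ?] := derives_unique dG (derives_str u); subst m m'.
exists (Ls ++ Rs); split.
- by apply: weight_cat_lt => /=; lia.
- by rewrite all_cat mL.
- by apply: eqv_vcomp_to_cat dL _; apply: eqv_idl.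
Qed.

(** The trailing identity of [vcomp_to] is absorbed by the last multistep, which exists because the
    sequence is nonempty. *)
Lemma vcomp_to_vcomp s t F Fs :
  derives (vcomp_to t (F :: Fs)) s t ->
  eqv s t (vcomp_to t (F :: Fs)) (vcomp F Fs).
Proof.
elim: Fs F s => [|G Fs IH] F s /derives_vert_inv [m dF dFs].
  have [? _] := derives_unique dFs (derives_str t); subst m.
  exact: eqv_idr.
by apply: eqv_vert (eqv_refl dF) (IH _ _ dFs).
Qed.

(** Multisteps contain no [Vert], so the last member of the chain cannot be mistaken for a further
    vertical composition. *)
Lemma vcomp_inj F F' Fs Fs' :
  all (@nonempty_multistep S) (F :: Fs) ->
  all (@nonempty_multistep S) (F' :: Fs') ->
  vcomp F Fs = vcomp F' Fs' -> F = F' /\ Fs = Fs'.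
Proof.
elim: Fs F F' Fs' => [|G Fs IH] F F' [|G' Fs'] /=.
- by move=> _ _ ->.
- by move=> /andP [/andP [mF _] _] _ def_F; move: mF; rewrite def_F.
- by move=> _ /andP [/andP [mF _] _] def_F; move: mF; rewrite -def_F.
- move=> /andP [_ nF] /andP [_ nF'] [-> e].
  by have [-> ->] := IH _ _ _ nF nF' e.
Qed.

Lemma vcomp_greedy F Fs :
  proof_term (vcomp F Fs) -> all (@nonempty_multistep S) (F :: Fs) ->
  unloath (F :: Fs) -> greedy (vcomp F Fs).
Proof.
move=> pF nF uF; split; first by right; exists F, Fs.
by move=> F' Fs' [e nF' _]; have [<- <-] := vcomp_inj nF nF' e.
Qed.

(** The condition on pairs is vacuous: a string is neither a vertical composition nor a multistep
    with a rule. *)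
Lemma str_greedy s : greedy (str s).
Proof.
split; first by left; rewrite /empty_multistep multistep_str count_rule_str.
move=> F [|G Fs] [/= e nF _]; last first.
  by have := multistep_str s; rewrite e.
by move: nF; rewrite -e /nonempty_multistep count_rule_str andbF.
Qed.

Lemma greedy_exists g :
  proof_term g -> exists2 g', greedy g' & perm_equiv g g'.
Proof.
case=> s [t] dg; have [Fs mF e] := derives_eqv_vcomp_to dg.
have [_ dF _] := e; have [Gs [nG uG e']] := vcomp_to_unloath mF dF.
have {e e'} e := eqv_trans e e'.
case: Gs nG uG e => [|G Gs] nG uG e.
  by exists (str t); [exact: str_greedy|case: e].
have [_ dG _] := e.
have [_ dG' e'] := eqv_trans e (vcomp_to_vcomp dG).
by exists (vcomp G Gs) => //; apply: vcomp_greedy => //; exists s, t.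
Qed.

End Existence.

(** * Histories *)

(* [Produced p ts a] is a letter [a] created by the rule [p] from the tokens
   [ts].  The position of [a] in [rhs p] need not be recorded. *)
Inductive token (S : srs) : Type :=
| Initial of letter S
| Produced of rule S & seq (token S) & letter S.

Arguments Initial {S} _.
Arguments Produced {S} _ _ _.

Definition label (S : srs) (t : token S) : letter S :=
  match t with Initial a => a | Produced _ _ a => a end.

(** The length of the longest causal chain of rule applications behind a token. The inner maximum is
    [max_depth], written out because it is part of the recursion. *)
Fixpoint depth (S : srs) (t : token S) : nat :=
  match t with
  | Initial _ => 0
  | Produced _ ts _ => (foldr maxn 0 (map (@depth S) ts)).+1
  end.

Definition max_depth (S : srs) (ts : seq (token S)) : nat :=
  foldr maxn 0 (map (@depth S) ts).

Definition products (S : srs) (p : rule S) (ts : seq (token S)) :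
    seq (token S) :=
  [seq Produced p ts a | a <- rhs p].

(** The action is a relation, since it is defined only on tokens whose labels spell the source. Its
    constructors go by the head atom, so inversion is unambiguous. *)
Inductive runs (S : srs) :
  preterm S -> seq (token S) -> seq (token S) -> Prop :=
| runs_nil : runs [::] [::] [::]
| runs_letter t g x y :
    runs g x y -> runs (Letter (label t) :: g) (t :: x) (t :: y)
| runs_rule p ts g x y :
    map (@label S) ts = lhs p -> runs g x y ->
    runs (Rule p :: g) (ts ++ x) (products p ts ++ y)
| runs_vert g d e x1 y1 z1 x2 z2 :
    runs g x1 y1 -> runs d y1 z1 -> runs e x2 z2 ->
    runs (Vert g d :: e) (x1 ++ x2) (z1 ++ z2).

(* A run of a multistep on tokens of depth at most [n] in which every rule
   consumes a token of depth [n]. *)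
Inductive stage (S : srs) (n : nat) :
  preterm S -> seq (token S) -> seq (token S) -> Prop :=
| stage_nil : stage n [::] [::] [::]
| stage_letter t F x y :
    depth t <= n -> stage n F x y ->
    stage n (Letter (label t) :: F) (t :: x) (t :: y)
| stage_rule p ts F x y :
    map (@label S) ts = lhs p -> max_depth ts = n -> stage n F x y ->
    stage n (Rule p :: F) (ts ++ x) (products p ts ++ y).

(* The multisteps are listed from the last to the first. *)
Inductive layered (S : srs) : seq (preterm S) -> seq (token S) -> Prop :=
| layered_nil x : max_depth x = 0 -> layered [::] x
| layered_cons F Fs x y :
    0 < count (@is_rule S) F -> stage (size Fs) F x y -> layered Fs x ->
    layered (F :: Fs) y.

Section Uniqueness.

Variable S : srs.
Implicit Types (F G g d e : preterm S) (Fs Gs : seq (preterm S)).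
Implicit Types (t : token S) (x y z ts : seq (token S)).

Lemma map_label_products p ts : map (@label S) (products p ts) = rhs p.
Proof. by rewrite /products -map_comp map_id. Qed.

Lemma products_cons p ts :
  exists a r, products p ts = Produced p ts a :: r.
Proof.
rewrite /products; case: (rhs p) (@rhs_nonempty S p) => // a r _.
by exists a, [seq Produced p ts b | b <- r].
Qed.

(** The output block is nonempty and its first token records both [p] and [ts], so a rule
    application can be read off the front of its result. *)
Lemma products_cat_inj p p' ts ts' y y' :
  products p ts ++ y = products p' ts' ++ y' -> [/\ p = p', ts = ts' & y = y'].
Proof.
move=> e; have [a [r def_p]] := products_cons p ts.
have [a' [r' def_p']] := products_cons p' ts'.
have [ep ets] : p = p' /\ ts = ts'.
  by move: e; rewrite def_p def_p' /= => -[-> -> _ _].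
split=> //; move: e; rewrite -ep -ets; elim: (products p ts) => //= t l IH [].
exact: IH.
Qed.

Lemma max_depth_le ts n : (max_depth ts <= n) = all (fun t => depth t <= n) ts.
Proof.
by elim: ts => //= t ts IH; rewrite /max_depth /= geq_max; congr andb.
Qed.

Lemma max_depth_cat x y :
  max_depth (x ++ y) = maxn (max_depth x) (max_depth y).
Proof.
by elim: x => [|t x IH]; rewrite ?max0n // /max_depth /= -maxnA; congr maxn.
Qed.

Lemma max_depth_products p ts : max_depth (products p ts) = (max_depth ts).+1.
Proof.
rewrite /products; case: (rhs p) (@rhs_nonempty S p) => // a r _.
rewrite /max_depth /= -/(max_depth ts).
elim: r => [|b r IH] /=; first by rewrite maxn0.
by rewrite -/(max_depth ts) IH maxnn.
Qed.

(** * The action of proof terms on tokens *)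

Lemma runs_derives g x y :
  runs g x y -> derives g (map (@label S) x) (map (@label S) y).
Proof.
elim=> {g x y} [|t g x y _ IH|p ts g x y e _ IH
  |g d e x1 y1 z1 x2 z2 _ IH1 _ IH2 _ IH3].
- exact: derives_nil.
- exact: (derives_cat (derives_letter (label t)) IH).
- rewrite !map_cat map_label_products e.
  exact: (derives_cat (derives_rule p) IH).
- rewrite !map_cat; exact: (derives_cat (derives_vert IH1 IH2) IH3).
Qed.

Lemma runs_cat g d x1 x2 y1 y2 :
  runs g x1 y1 -> runs d x2 y2 -> runs (g ++ d) (x1 ++ x2) (y1 ++ y2).
Proof.
move=> h h2; elim: h => {g x1 y1} //= *; rewrite -?catA; econstructor; eassumption.
Qed.

Lemma runs_cat_inv g d x y :
  runs (g ++ d) x y ->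
  exists x1 x2 y1 y2,
    [/\ x = x1 ++ x2, y = y1 ++ y2, runs g x1 y1 & runs d x2 y2].
Proof.
elim: g x y => [|c g IH] x y /=.
  by exists [::], x, [::], y; split=> //; constructor.
move=> h; inversion h as [|t g' x' y' h' |p ts g' x' y' e h'
  |g' d' e' x1 y1 z1 x' y' h1 h2 h']; subst;
  have [u1 [u2 [v1 [v2 [-> -> r1 r2]]]]] := IH _ _ h'.
- by exists (t :: u1), u2, (t :: v1), v2; split=> //; constructor.
- exists (ts ++ u1), u2, (products p ts ++ v1), v2.
  by rewrite -!catA; split=> //; constructor.
- exists (x1 ++ u1), u2, (z1 ++ v1), v2.
  by rewrite -!catA; split=> //; apply: runs_vert; eassumption.
Qed.

Lemma runs_vertE g d x z :
  runs (vert g d) x z <-> exists2 y, runs g x y & runs d y z.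
Proof.
split=> [h|[y h1 h2]].
  inversion h as [| | |g' d' e' x1 y1 z1 x2 z2 h1 h2 h3]; subst.
  by inversion h3; subst; rewrite !cats0; exists y1.
rewrite -[x]cats0 -[z]cats0; apply: runs_vert h1 h2 _; exact: runs_nil.
Qed.

Lemma runs_str x : runs (str (map (@label S) x)) x x.
Proof. by elim: x => [|t x IH]; [exact: runs_nil|exact: runs_letter]. Qed.

Lemma runs_str_inv s x y : runs (str s) x y -> x = y.
Proof.
elim: s x y => [|a s IH] x y h; inversion h => //; subst.
by congr cons; apply: IH.
Qed.

Lemma runs_total g s s' x :
  derives g s s' -> map (@label S) x = s -> exists y, runs g x y.
Proof.
move=> dg; elim: dg x => {g s s'}
  [|a|p|g1 g2 s1 s2 t1 t2 _ IH1 _ IH2|g d s m u d1 IH1 d2 IH2] x.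
- by case: x => // _; exists [::]; constructor.
- by case: x => // t [|? ?] // [<-]; exists [:: t]; do 2 constructor.
- move=> e; exists (products p x).
  by have := runs_rule e (runs_nil S); rewrite !cats0.
- move=> e; rewrite -(cat_take_drop (size s1) x).
  have [|y1 h1] := IH1 (take (size s1) x); first by rewrite map_take e take_size_cat.
  have [|y2 h2] := IH2 (drop (size s1) x); first by rewrite map_drop e drop_size_cat.
  by exists (y1 ++ y2); apply: runs_cat.
- move=> e; have [y h1] := IH1 x e.
  have [_ ey] := derives_unique (runs_derives h1) d1.
  by have [z h2] := IH2 y ey; exists z; apply/runs_vertE; exists y.
Qed.

Lemma perm_equiv_runs g d x y : perm_equiv g d -> runs g x y <-> runs d x y.
Proof.
move=> h; elim: h x y => {g d}.
- by [].
- by move=> g d _ IH x y; rewrite IH.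
- by move=> g d z _ IH1 _ IH2 x y; rewrite IH1.
- move=> g g' d d' _ IH1 _ IH2 x y.
  by split=> /runs_cat_inv [x1] [x2] [y1] [y2] [-> ->] /IH1 h1 /IH2 h2;
    apply: runs_cat.
- move=> g g' d d' _ IH1 _ IH2 _ _ x y.
  by rewrite !runs_vertE; split=> -[m /IH1 h1 /IH2 h2]; exists m.
- move=> s g [u] [v] /derives_vert_inv [m h1 h2] _ x y.
  rewrite runs_vertE; split=> [[x' /runs_str_inv -> //]|h]; exists x => //.
  have [? _] := derives_unique (runs_derives h) h2.
  have [_ ?] := derives_unique h1 (derives_str s).
  by subst; apply: runs_str.
- move=> g s [u] [v] /derives_vert_inv [m h1 h2] _ x y.
  rewrite runs_vertE; split=> [[y' h /runs_str_inv <- //]|h]; exists y => //.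
  have [_ ?] := derives_unique (runs_derives h) h1.
  have [? _] := derives_unique h2 (derives_str s).
  by subst; apply: runs_str.
- move=> g d e _ _ x y; rewrite !runs_vertE; split.
    move=> [y2 /runs_vertE [y1 h1 h2] h3].
    by exists y1 => //; apply/runs_vertE; exists y2.
  move=> [y1 h1 /runs_vertE [y2 h2 h3]].
  by exists y2 => //; apply/runs_vertE; exists y1.
- move=> g d z e _ [u] [v] /derives_cat_inv [u1] [u2] [v1] [v2] [_ _].
  move=> /derives_vert_inv [m1 dg dz] /derives_vert_inv [m2 dd de] x y.
  rewrite runs_vertE; split.
    move=> [m /runs_cat_inv [x1] [x2] [w1] [w2] [-> -> h1 h2]].
    move=> /runs_cat_inv [w1'] [w2'] [y1] [y2] [ew -> h3 h4].
    (* Both [w1] and [w1'] spell [m1], the target of [g] and source of [z], so the two cuts of the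
       intermediate token string agree. *)
    have size_w : size w1 = size w1'.
      rewrite -(size_map (@label S)) -(size_map (@label S) w1').
      have [_ ->] := derives_unique (runs_derives h1) dg.
      by have [-> _] := derives_unique (runs_derives h3) dz.
    have e1 : w1 = w1'.
      by have := congr1 (take (size w1)) ew; rewrite {2}size_w !take_size_cat.
    have e2 : w2 = w2'.
      by have := congr1 (drop (size w1)) ew; rewrite {2}size_w !drop_size_cat.
    by subst; apply: runs_cat; apply/runs_vertE; [exists w1'|exists w2'].
  move=> /runs_cat_inv [x1] [x2] [y1] [y2] [-> ->].
  move=> /runs_vertE [w1 h1 h3] /runs_vertE [w2 h2 h4].
  by exists (w1 ++ w2); apply: runs_cat.
Qed.

(** * Stages *)

(** Copied tokens have depth at most [n], and produced ones have depth exactly [n.+1]. *)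
Lemma stage_max_depth n F x y : stage n F x y -> max_depth y <= n.+1.
Proof.
elim=> {F x y} [|t F x y le_tn _ IH|p ts F x y _ e _ IH] //.
  by rewrite /max_depth /= geq_max -/(max_depth y) IH andbT; apply: leqW.
by rewrite max_depth_cat max_depth_products e geq_max leqnn.
Qed.

Lemma stage_nonempty n F x y :
  stage n F x y -> 0 < count (@is_rule S) F -> max_depth y = n.+1.
Proof.
move=> h; elim: h => {F x y} [|t F x y le_tn _ IH|p ts F x y _ e h _ _] //=.
  by move/IH; rewrite /max_depth /= => ->; apply/maxn_idPr/leqW.
rewrite max_depth_cat max_depth_products e.
by apply/maxn_idPl; apply: stage_max_depth h.
Qed.

(** The output is parsed from the left. A head token of depth at most [n] was copied by a letter; a
    deeper one opens the output block of a rule, which [products_cat_inj] identifies together with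
    its inputs. *)
Lemma stage_unique n F F' x x' y :
  stage n F x y -> stage n F' x' y -> F = F' /\ x = x'.
Proof.
move=> h; elim: h F' x' => {F x y} [|t F x y le_tn _ IH|p ts F x y _ e _ IH] F' x' h.
- inversion h as [| |p ts F1 x1 y1 l1 e1 h1 q1 q2 e] => //.
  by have [a [r def_p]] := products_cons p ts; rewrite def_p in e.
- inversion h as [|t' F1 x1 y1 le1 h'|p ts F1 x1 y1 l1 e1 h1 q1 q2 e].
    by subst; have [-> ->] := IH _ _ h'.
  have [a [r def_p]] := products_cons p ts; rewrite def_p in e.
  case: e => def_t _; move: le_tn.
  by rewrite -def_t /= -/(max_depth ts) e1 ltnn.
- inversion h as [e1 e2 e3|t' F1 x1 y1 le_tn h' e1 e2 e3
    |p' ts' F1 x1 y1 l1 k1 h' e1 e2 e3].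
  + by have [a [r def_p]] := products_cons p ts; rewrite def_p in e3.
  + have [a [r def_p]] := products_cons p ts; rewrite def_p in e3.
    case: e3 => def_t _; move: le_tn.
    by rewrite def_t /= -/(max_depth ts) e ltnn.
  + have [? ? ?] := products_cat_inj e3; subst.
    by have [-> ->] := IH _ _ h'.
Qed.

(** A token this shallow was copied rather than produced, so [F] has a letter at its place and can
    be cut there. *)
Lemma stage_split n F x y1 t y2 :
  stage n F x (y1 ++ t :: y2) -> depth t <= n ->
  exists F1 F2 x1 x2, [/\ F = F1 ++ Letter (label t) :: F2,
    stage n F1 x1 y1 & stage n F2 x2 y2].
Proof.
move def_y: (y1 ++ t :: y2) => y h le_tn.
elim: h y1 def_y => {F x y} [|t' F x y le_tn' h IH|p ts F x y e1 e2 h IH] y1.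
- by case: y1.
- case: y1 => [|t1 y1] /= [def_t def_y].
    by subst; exists [::], F, [::], x; split=> //; constructor.
  subst t1; have [F1 [F2 [x1 [x2 [-> h1 h2]]]]] := IH _ def_y.
  by exists (Letter (label t') :: F1), F2, (t' :: x1), x2; split=> //; constructor.
(* The token [t] cannot lie inside a block [l] of tokens deeper than [n], so the whole block
   precedes it. *)
- have split_products l y0 : all (fun t => n < depth t) l ->
      y0 ++ t :: y2 = l ++ y -> exists2 y1', y0 = l ++ y1' & y1' ++ t :: y2 = y.
    elim: l y0 => [|t' l IHl] y0 /=; first by exists y0.
    case/andP=> lt_nt' deep_l; case: y0 => [|t0 y0] /= [def_t].
      by move: lt_nt'; rewrite -def_t ltnNge le_tn.
    by move/(IHl _ deep_l) => [y1' -> def_y]; rewrite def_t; exists y1'.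
  have deep : all (fun t => n < depth t) (products p ts).
    rewrite /products all_map; elim: (rhs p) => //= a r ->.
    by rewrite -/(max_depth ts) e2 leqnn.
  move/(split_products _ _ deep) => [y1' -> /IH].
  move=> [F1] [F2] [x1] [x2] [-> h1 h2].
  by exists (Rule p :: F1), F2, (ts ++ x1), x2; split=> //; constructor.
Qed.

Lemma stage_prefix n F x ts y :
  stage n F x (ts ++ y) -> max_depth ts <= n ->
  exists F2 x2, F = str (map (@label S) ts) ++ F2 /\ stage n F2 x2 y.
Proof.
elim: ts F x => [|t ts IH] F x /=; first by exists F, x.
rewrite {1}/max_depth /= geq_max => h /andP [le_tn le_tsn].
inversion h as [|t' F1 x1 y1 le1 h'|p us F1 x1 y1 l1 e1 h1 q1 q2 e].
  by subst; have [F2 [x2 [-> h2]]] := IH _ _ h' le_tsn; exists F2, x2.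
have [a [r def_p]] := products_cons p us; rewrite def_p in e.
case: e => def_t _; move: le_tn.
by rewrite -def_t /= -/(max_depth us) e1 ltnn.
Qed.

(** * Non-loath pairs form consecutive stages *)

Lemma residual_cat G F H G' F' H' :
  residual G F H -> residual G' F' H' ->
  residual (G ++ G') (F ++ F') (H ++ H').
Proof.
by move=> h h'; elim: h => {G F H} //= *; rewrite -?catA; constructor.
Qed.

Lemma residual_refl n F x y :
  stage n F x y -> residual F F (str (map (@label S) y)).
Proof.
elim=> {F x y} [|t F x y _ _ IH|p ts F x y _ _ _ IH] /=; try by constructor.
by rewrite map_cat map_label_products str_cat; constructor.
Qed.

Lemma mle_cat F F' G G' : mle F G -> mle F' G' -> mle (F ++ F') (G ++ G').
Proof.
by move=> h h'; elim: h => {F G} //= *; rewrite -?catA; constructor.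
Qed.

Lemma mle_source F x y :
  runs F x y -> multistep F -> mle (str (map (@label S) x)) F.
Proof.
elim=> {F x y} [|t F x y _ IH mF|p ts F x y e _ IH mF|] //=.
- by move=> _; apply: mle_nil.
- by apply: mle_letter; apply: IH.
- by rewrite map_cat e str_cat; apply: mle_replace; apply: IH.
Qed.

(* A rule none of whose inputs was produced by [F] already applies to letters
   of [F], since right-hand sides are nonempty. *)
Lemma old_inputs_loath n F x y1 ts y2 G1 p G2 z1 z2 :
  stage n F x (y1 ++ ts ++ y2) -> map (@label S) ts = lhs p ->
  max_depth ts <= n ->
  runs G1 y1 z1 -> runs G2 y2 z2 -> multistep (G1 ++ Rule p :: G2) ->
  loath F (G1 ++ Rule p :: G2).
Proof.
move=> h e le_tsn r1 r2; rewrite multistep_cat => /andP [mG1 mG2].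
(* Since [lhs p] is nonempty there is a first input [t], which locates the copy of [lhs p] in
   [F]. *)
case: ts e le_tsn h => [e|t ts e]; first by case: (@lhs_nonempty S p).
rewrite {1}/max_depth /= geq_max => /andP [le_tn le_tsn] h.
have [F1 [F' [x1 [x' [-> h1 h']]]]] := stage_split h le_tn.
have [F2 [x2 [-> h2]]] := stage_prefix h' le_tsn.
(* The witness for X is [F] with this copy of [lhs p] replaced by [p]; its residual after [F] is the
   step applying [p] alone. *)
exists (F1 ++ Rule p :: F2),
  (str (map (@label S) y1) ++ Rule p :: str (map (@label S) y2)).
have res : residual (F1 ++ Rule p :: F2)
    (F1 ++ Letter (label t) :: str (map (@label S) ts) ++ F2)
    (str (map (@label S) y1) ++ Rule p :: str (map (@label S) y2)).
  apply: residual_cat (residual_refl h1) _.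
  have -> : Letter (label t) :: str (map (@label S) ts) ++ F2
      = str (lhs p) ++ F2 by rewrite -e.
  exact: res_replace (residual_refl h2).
split=> //.
- by apply/residual_exists; eexists; exact: res.
- by rewrite /step multistep_cat /multistep /= -!/(multistep _) !multistep_str
    count_cat /= !count_rule_str.
- by apply: mle_cat (mle_source r1 mG1) _; apply/mle_keep/(mle_source r2 mG2).
Qed.

(** After stage [n] all tokens have depth at most [n.+1]. A rule of [G] whose inputs all have depth
    at most [n] would make the pair loath by [old_inputs_loath], so its inputs have maximal depth
    exactly [n.+1]. *)
Lemma stage_next n F x y G z :
  stage n F x y -> runs G y z -> multistep G -> ~ loath F G ->
  stage n.+1 G y z.
Proof.
move=> hF hG mG not_loath.
(* The induction runs over a suffix [G2] and remembers the prefix [G1], because loathness concerns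
   the whole of [G]. *)
suff main G1 y1 z1 G2 y2 z2 :
    runs G1 y1 z1 -> runs G2 y2 z2 -> G = G1 ++ G2 -> y = y1 ++ y2 ->
    stage n.+1 G2 y2 z2 by exact: (main [::] [::] [::] _ _ _ (runs_nil S) hG).
have := stage_max_depth hF.
move=> le_y r1 r2; elim: r2 G1 y1 z1 r1 => {G2 y2 z2}
  [|t G2 y2 z2 r2 IH|p ts G2 y2 z2 e r2 IH|g d G2 ? ? ? ? ? _ _ _ _ _ _]
  G1 y1 z1 r1 def_G def_y.
- exact: stage_nil.
- apply: stage_letter.
    by move: le_y; rewrite max_depth_le def_y all_cat /= => /and3P [].
  apply: (IH _ _ _ (runs_cat r1 (runs_letter t (runs_nil S))));
    by rewrite -catA.
- have r1' := runs_cat r1 (runs_rule e (runs_nil S)).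
  apply: stage_rule => //; last by apply: IH r1' _ _; rewrite ?cats0 -catA.
  apply/eqP; rewrite eqn_leq; apply/andP; split.
    by move: le_y; rewrite def_y !max_depth_cat !geq_max => /and3P [].
  rewrite ltnNge; apply/negP => le_tsn; apply: not_loath.
  subst G y; exact: old_inputs_loath hF e le_tsn r1 r2 mG.
- by move: mG; rewrite def_G multistep_cat andbC.
Qed.

Lemma stage0 F x y :
  runs F x y -> multistep F -> max_depth x = 0 -> stage 0 F x y.
Proof.
elim=> {F x y} [|t F x y _ IH|p ts F x y e _ IH|] //=.
- by move=> _ _; apply: stage_nil.
- move=> mF /eqP; rewrite -leqn0 max_depth_le /= => /andP [le_t0 le_x0].
  by apply: stage_letter => //; apply: IH => //; apply/eqP;
    rewrite -leqn0 max_depth_le.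
- move=> mF /eqP; rewrite max_depth_cat -leqn0 geq_max !leqn0.
  by case/andP=> /eqP ets /eqP ex; apply: stage_rule => //; apply: IH.
Qed.

(** * Layers determine the reduction *)

Lemma layered_max_depth Fs y : layered Fs y -> max_depth y = size Fs.
Proof. by case=> // F Gs x z cF h _; apply: stage_nonempty h cF. Qed.

(** The depth of [y] fixes the number of layers, so both last layers belong to the same stage;
    [stage_unique] identifies them and their inputs, and the argument repeats. *)
Lemma layered_unique Fs Gs y : layered Fs y -> layered Gs y -> Fs = Gs.
Proof.
move=> hF hG.
have size_FG : size Fs = size Gs.
  by rewrite -(layered_max_depth hF) (layered_max_depth hG).
elim: hF Gs hG size_FG => {Fs y} [y _ [] //|F Fs x y _ h _ IH] Gs hG.
case: hG h => // G {}Gs x' {}y _ h' hG h [size_FG].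
rewrite -size_FG in h'; have [? ?] := stage_unique h h'; subst.
by rewrite (IH _ hG size_FG).
Qed.

(** Invariant for running the rest [Fs] of a reduction from the tokens [y] left by [F]: each
    multistep is pushed on top of the layers, so the order is reversed. The case distinction is
    there because [vcomp] needs a first multistep. *)
Lemma vcomp_layered F Fs Rs y z :
  layered (F :: Rs) y -> all (@nonempty_multistep S) Fs -> unloath (F :: Fs) ->
  (if Fs is G :: Gs then runs (vcomp G Gs) y z else y = z) ->
  layered (catrev Fs (F :: Rs)) z.
Proof.
elim: Fs F Rs y => [|G Gs IH] F Rs y /= hF; first by move=> _ _ <-.
case/andP=> /andP [mG cG] nGs uF.
have next y' : runs G y y' -> layered [:: G, F & Rs] y'.
  move=> rG; apply: (layered_cons (x := y)) => //.
  inversion hF as [|F' Rs' x y0 cF h hx]; subst.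
  by apply: stage_next h rG mG _; apply: (uF [::]).
have uG : unloath (G :: Gs).
  by move=> Ls G1 G2 Rs' def_G; apply: (uF (F :: Ls)); rewrite def_G.
case: Gs IH nGs uG {uF} => [|H Hs] IH nGs uG.
  by move/next => hG; apply: IH hG nGs uG _.
by move/runs_vertE => [y' /next hG hH]; apply: IH hG nGs uG hH.
Qed.

(** The second conclusion expresses [g] through [Fs] and [y] alone, so equal layerings of the same
    result give equal reductions. Having no layer corresponds to [g] being a string. *)
Lemma greedy_layered g x y :
  greedy g -> runs g x y -> max_depth x = 0 ->
  exists2 Fs, layered Fs y
    & g = if rev Fs is F :: Gs then vcomp F Gs else str (map (@label S) y).
Proof.
case=> -[/andP [mg /eqP cg] _|[F [Fs cF]] uF] rg x0.
  have [s def_g] := empty_multistep_str mg cg; subst g.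
  have ? := runs_str_inv rg; subst y; exists [::]; first exact: layered_nil.
  by have [-> _] := derives_unique (derives_str s) (runs_derives rg).
have [def_g nF _] := cF; have {}uF : unloath (F :: Fs) := uF F Fs cF.
have /= /andP [/andP [mF posF] nFs] := nF.
exists (rev (F :: Fs)); last by rewrite revK.
have first_layer y' : runs F x y' -> layered [:: F] y'.
  move=> rF; apply: (layered_cons (x := x)) => //; last exact: layered_nil.
  exact: stage0.
rewrite /rev /=; subst g; case: Fs {cF nF} nFs uF rg => [|G Gs] nFs uF.
  by move/first_layer => hF; apply: vcomp_layered hF nFs uF _.
by move/runs_vertE => [y' /first_layer hF hG]; apply: vcomp_layered hF nFs uF hG.
Qed.

Lemma max_depth_initial s : max_depth (map (@Initial S) s) = 0.
Proof. by elim: s => //= a s IH; rewrite /max_depth /= max0n. Qed.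

Lemma greedy_unique g d : greedy g -> greedy d -> perm_equiv g d -> g = d.
Proof.
move=> greedy_g greedy_d e; have [s [s' [dg _ _]]] := perm_equiv_eqv e.
(* Both reductions act on the initial tokens spelling their common source, and equivalence gives
   them the same result [y]. *)
have [|y rg] := runs_total (x := map (@Initial S) s) dg.
  by rewrite -map_comp map_id.
have rd := (perm_equiv_runs _ _ e).1 rg.
have [Fs hF ->] := greedy_layered greedy_g rg (max_depth_initial s).
have [Gs hG ->] := greedy_layered greedy_d rd (max_depth_initial s).
by rewrite (layered_unique hF hG).
Qed.

End Uniqueness.

Theorem theorem35 (S : srs) (g : preterm S) (hg : proof_term g) :
  exists! g' : preterm S, greedy g' /\ perm_equiv g g'.
Proof.
have [g' greedy_g' e] := greedy_exists hg.
exists g'; split=> // d [greedy_d e']; apply: greedy_unique => //.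
exact: pe_trans (pe_sym e) e'.
Qed.
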